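(* Let $\mathbb{K}$ be a field and let $I\subseteq S=\mathbb{K}[x_1,\ldots,x_n]$ be a monomial ideal such that $\mathcal{F}(I)=\mathcal{F}(\sqrt{I})$ and the irreducible decomposition of $I$ is minimal. If $\alpha_I(F)\ge 2$ for some $F\in\mathcal{F}(I)$, then $I^{(2)}\neq I^2$.
   Context: For a monomial $\mathbf{x}^{\mathbf{a}}=x_1^{a_1}\cdots x_n^{a_n}$, $\operatorname{supp}(\mathbf{x}^{\mathbf{a}})=\{x_i\mid a_i\neq 0\}$. $\mathcal{G}(I)$ is the minimal monomial generating set of $I$, and $\mathcal{F}(I)=\{\operatorname{supp}(\mathbf{x}^{\mathbf{a}})\mid \mathbf{x}^{\mathbf{a}}\in\mathcal{G}(I)\}$. For $F\in\mathcal{F}(I)$, $\alpha_I(F)$ is the number of elements of $\mathcal{G}(I)$ whose support equals $F$. Symbolic powers: $I^{(s)}=\bigcap_{P\in\operatorname{MinAss}(I)}(I^sS_P\cap S)$, where $\operatorname{MinAss}(I)$ is the set of minimal primes of $I$. Irreducible monomial ideals are those generated by powers of distinct variables. Every monomial ideal has a unique irredundant decomposition as an intersection of irreducible monomial ideals (its irreducible decomposition). It is called minimal if it is a minimal primary decomposition, i.e. distinct components have distinct radicals. *)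

(* Defs.v *)
From HB Require Import structures.
From mathcomp Require Import all_boot all_order all_algebra.
From mathcomp Require Import finmap boolp classical_sets functions cardinality.
From mathcomp Require Import ring_quotient fraction mpoly.

Set Implicit Arguments.
Unset Strict Implicit.
Unset Printing Implicit Defensive.

Import GRing.Theory.
Local Open Scope ring_scope.
Local Open Scope classical_set_scope.

(* Ideals are Prop-valued sets, possibly improper; [B] is a subring of [R], so
   that the same notion serves for ideals of [R] itself ([B = setT]) and for
   ideals of a localization seen inside a fraction field. *)
Definition is_ideal_of (R : comNzRingType) (B A : set R) : Prop :=
  [/\ A `<=` B, A 0, (forall x y, A x -> A y -> A (x + y))
    & (forall b x, B b -> A x -> A (b * x))].

Definition ideal_span_of (R : comNzRingType) (B X : set R) : set R :=
  smallest (is_ideal_of B) X.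

Definition ideal_span (R : comNzRingType) (X : set R) : set R :=
  ideal_span_of setT X.

Definition ideal_pow (R : comNzRingType) (I : set R) (s : nat) : set R :=
  ideal_span [set h | exists2 f : 'I_s -> R,
                        (forall i, I (f i)) & h = \prod_(i < s) f i].

Definition radical (R : comNzRingType) (I : set R) : set R :=
  [set f | exists k : nat, I (f ^+ k)].

(* [idealr_closed] already requires [1 \notin P]. *)
Definition is_prime_ideal (R : comNzRingType) (P : set R) : Prop :=
  idealr_closed (mem P) /\ prime_idealr_closed (mem P).

Definition min_ass (R : comNzRingType) (I : set R) : set (set R) :=
  [set P | [/\ is_prime_ideal P, I `<=` P
    & forall Q, is_prime_ideal Q -> I `<=` Q -> Q `<=` P -> Q = P]].

(* The localization of the domain [R] at [P], as a subring of Frac(R). *)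
Definition loc_ring (R : idomainType) (P : set R) : set {fraction R} :=
  [set z | exists a b : R, ~ P b /\ z = tofrac a / tofrac b].

Definition loc_contract (R : idomainType) (P J : set R) : set R :=
  (@tofrac R) @^-1` ideal_span_of (loc_ring P) ((@tofrac R) @` J).

Definition symbolic_pow (R : idomainType) (I : set R) (s : nat) : set R :=
  \bigcap_(P in min_ass I) loc_contract P (ideal_pow I s).

Section MonomialIdeals.
Variables (K : fieldType) (n : nat).
Local Notation S := {mpoly K[n]}.
Implicit Types (I Q : set S) (G H : set 'X_{1..n}) (F : {set 'I_n}).

Definition mon_span G : set S := ideal_span [set 'X_[a] | a in G].

Definition is_monomial_ideal I : Prop := exists G, I = mon_span G.

Definition is_min_mon_gens I G : Prop :=
  I = mon_span G /\ (forall H, H `<=` G -> I = mon_span H -> H = G).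

(* For a monomial ideal there is exactly one [G] with [is_min_mon_gens I G]. *)
Definition min_gens I : set 'X_{1..n} :=
  [set a | exists2 G, is_min_mon_gens I G & G a].

Definition mon_supp (a : 'X_{1..n}) : {set 'I_n} := [set i | a i != 0%N]%SET.

Definition gens_supports I : set {set 'I_n} := mon_supp @` min_gens I.

(* [fset_set] returns a junk value on infinite sets, but [min_gens I] is always
   finite by Dickson's lemma. *)
Definition alpha I F : nat :=
  #|` fset_set [set a | min_gens I a /\ mon_supp a = F] |.

Definition is_irreducible_monomial_ideal Q : Prop :=
  exists (A : {set 'I_n}) (b : 'I_n -> nat),
    (forall i, i \in A -> (0 < b i)%N) /\
    Q = ideal_span [set f | exists2 i, i \in A & f = 'X_i ^+ b i].

Definition is_irreducible_decomposition I (r : nat) (Q : 'I_r -> set S) : Prop :=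
  [/\ (forall i, is_irreducible_monomial_ideal (Q i)),
      I = \bigcap_(i in [set: 'I_r]) Q i
    & (forall i, \bigcap_(j in [set j | j != i]) Q j <> I)].

(* The components of an irredundant decomposition are pairwise distinct, so
   injectivity on indices says that distinct components have distinct
   radicals. *)
Definition has_minimal_irreducible_decomposition I : Prop :=
  exists (r : nat) (Q : 'I_r -> set S),
    is_irreducible_decomposition I Q /\ injective (fun i => radical (Q i)).

End MonomialIdeals.

(* Main.v *)
From HB Require Import structures.
Require Import Defs.
From mathcomp Require Import all_boot all_order all_algebra.
From mathcomp Require Import finmap boolp classical_sets cardinality.
From mathcomp Require Import ring_quotient fraction mpoly ring zify.

(** Let F be a support carrying at least two minimal generators of [I], let
    x^a be one of least degree, and x^b one of least degree among the others.
    The monomial x^f with f_k = max (a_k, b_k, 2 min (a_k, b_k)), the lcm of x^a,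
    x^b and gcd (x^a, x^b)^2, lies in the second symbolic power of [I] but not in
    its square.

    Membership in the symbolic power ([lcm_sqr_gcd_symbolic]).  Since distinct
    irreducible components have distinct radicals, exactly one component Q is
    contained in a given minimal prime P, and some s outside P satisfies
    s Q <= I ([local_component]): locally at P the ideal [I] is the irreducible
    ideal Q.  It therefore suffices that x^f is a multiple of a product of two
    elements of Q ([irreducible_lcm_sqr_gcd]).  If Q is generated by the pure
    powers x_k^(q_k), then some x_i^(q_i) divides x^a and some x_j^(q_j) divides
    x^b; for i <> j their product divides the lcm of x^a and x^b, and for i = j
    it is x_i^(2 q_i), with q_i <= min (a_i, b_i).

    Failure of membership in the square.  Otherwise c + d <= f for two minimal
    generators x^c, x^d ([monomial_sqrX], [minimal_mon_below]).  The supports of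
    minimal generators form an antichain, because they are those of a radical
    monomial ideal ([minimal_supp_antichain]); hence both generators have support
    F.  Now f <= a + b, and f_k < a_k + b_k at any k where a_k > b_k (> 0), so
    deg c + deg d < deg a + deg b, and the choice of a and b forces c = d = a.
    But then 2 a_k <= f_k = max (a_k, 2 b_k) at that same k, which is absurd. *)

Set Implicit Arguments.
Unset Strict Implicit.
Unset Printing Implicit Defensive.

Import GRing.Theory.
Local Open Scope ring_scope.
Local Open Scope classical_set_scope.

(** * Ideals, radicals and primes of a commutative ring *)

Section Ideals.
Variable R : comNzRingType.
Implicit Types (I J P : set R).

Local Notation is_ideal := (is_ideal_of (@setT R)).

Lemma ideal_span_ideal (X : set R) : is_ideal (ideal_span X).
Proof.
split=> //.
- by move=> A [[]].
- move=> x y Xx Xy A idA; have [[_ _ AD _] _] := idA.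
  by apply: AD; [apply: Xx|apply: Xy].
- move=> b x _ Xx A idA; have [[_ _ _ AM] _] := idA.
  by apply: AM => //; apply: Xx.
Qed.

Lemma sub_ideal_span (X : set R) : X `<=` ideal_span X.
Proof. by move=> x Xx A [_]; apply. Qed.

Lemma ideal_span_min (X J : set R) :
  is_ideal J -> X `<=` J -> ideal_span X `<=` J.
Proof. by move=> idJ XJ x; apply. Qed.

Lemma sub_radical I : I `<=` radical I.
Proof. by move=> x Ix; exists 1%N; rewrite expr1. Qed.

Lemma radical_ideal I : is_ideal I -> is_ideal (radical I).
Proof.
case=> _ I0 ID IM; split=> //.
- by exists 1%N; rewrite expr1.
- move=> x y [k Ixk] [l Iyl]; exists (k + l)%N.
  rewrite exprDn; apply: (big_ind (fun f => I f)) => // i _.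
  rewrite -mulr_natl; apply: (IM) => //.
  (* In the i-th term, x^(k+l-i) y^i, either l <= i or k <= k + l - i. *)
  have [le_li|lt_il] := leqP l i.
    by rewrite -[X in y ^+ X](subnK le_li) exprD mulrA; apply: IM.
  have le_k : (k <= k + l - i)%N by lia.
  rewrite -(subnK le_k) exprD mulrC mulrA; exact: IM.
- by move=> b x _ [k Ixk]; exists k; rewrite exprMn; apply: IM.
Qed.

Lemma prime_idealM P x y : is_prime_ideal P -> P (x * y) -> P x \/ P y.
Proof.
case=> _ Pp Pxy; have /Pp/orP[] : x * y \in mem P by rewrite inE.
  by rewrite inE; left.
by rewrite inE; right.
Qed.

Lemma prime_ideal0 P : is_prime_ideal P -> P 0.
Proof. by case=> -[+ _ _] _; rewrite inE. Qed.

Lemma prime_idealN1 P : is_prime_ideal P -> ~ P 1.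
Proof. by case=> -[_ + _] _; rewrite notin_setE. Qed.

Lemma prime_idealX P x k : is_prime_ideal P -> P (x ^+ k) -> P x.
Proof.
move=> Pp; elim: k => [|k IHk]; first by rewrite expr0 => /(prime_idealN1 Pp).
by rewrite exprS => /(prime_idealM Pp) [].
Qed.

Lemma radical_sub_prime I P :
  is_prime_ideal P -> I `<=` P -> radical I `<=` P.
Proof. by move=> Pp IP x [k /IP]; apply: prime_idealX. Qed.

(** This gives primality of the radicals of irreducible monomial ideals, which
    are kernels of substitutions. *)
Lemma kernel_prime_ideal (A : idomainType) (phi : {rmorphism R -> A}) :
  is_prime_ideal [set f | phi f = 0].
Proof.
split; [split|].
- by rewrite inE /= rmorph0.
- by rewrite notin_setE /= rmorph1; apply/eqP/oner_neq0.
- by move=> a u v; rewrite !inE /= rmorphD rmorphM => -> ->; rewrite mulr0 addr0.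
- move=> u v; rewrite inE /= rmorphM => /eqP; rewrite mulf_eq0.
  by case/orP=> /eqP uv0; apply/orP; [left|right]; rewrite inE.
Qed.

(** Prime avoidance for an intersection: a product of elements, one from each
    ideal not inside [P], works. *)
Lemma avoid_prime (r : nat) (Q : 'I_r -> set R) (D : pred 'I_r) P :
  is_prime_ideal P -> (forall i, is_ideal (Q i)) ->
  (forall i, D i -> ~ Q i `<=` P) ->
  exists2 s, ~ P s & forall i, D i -> Q i s.
Proof.
move=> Pp idQ QP.
have /choice [h hP] (i : 'I_r) : exists h, ~ P h /\ (D i -> Q i h).
  case: (boolP (D i)) => Di.
    by have /existsNP[h /not_implyP[Qh nPh]] := QP _ Di; exists h.
  by exists 1; split=> //; apply: prime_idealN1.
exists (\prod_i h i).
  apply: (big_ind (fun f => ~ P f)); first exact: prime_idealN1.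
    by move=> x y nPx nPy /(prime_idealM Pp) [].
  by move=> i _; have [] := hP i.
move=> i Di; rewrite (bigD1 i) //= mulrC; have [_ _ _ QM] := idQ i.
by apply: QM => //; have [_] := hP i; apply.
Qed.

(** The radical of any component inside the minimal prime [P] is a prime between
    [I] and [P], hence equal to [P]; as the radicals are distinct, there is at
    most one such component, and there is one because [P] contains the
    intersection.  An element outside [P] that lies in all the other components
    clears them away. *)
Lemma local_component (r : nat) (Q : 'I_r -> set R) I P :
  I = \bigcap_(i in [set: 'I_r]) Q i ->
  (forall i, is_ideal (Q i)) ->
  (forall i, is_prime_ideal (radical (Q i))) ->
  injective (fun i => radical (Q i)) ->
  min_ass I P ->
  exists i, exists2 s, ~ P s & forall f, Q i f -> I (s * f).
Proof.
move=> defI idQ radQ injQ [Pp IP minP].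
have QP_rad i : Q i `<=` P -> radical (Q i) = P.
  move=> QP; apply: minP => //; last exact: radical_sub_prime.
  by rewrite defI => f /(_ i Logic.I); apply: sub_radical.
have [i QiP] : exists i, Q i `<=` P.
  apply/not_existsP => nQP.
  have [s nPs Qs] := avoid_prime (D := predT) Pp idQ (fun i _ => nQP i).
  by apply/nPs/IP; rewrite defI => i _; apply: Qs.
have [s nPs Qs] : exists2 s, ~ P s & forall j, j != i -> Q j s.
  apply: avoid_prime => // j /eqP neq_ji QjP; apply: neq_ji.
  by apply: injQ; rewrite !QP_rad.
exists i, s => // f Qf; rewrite defI => j _; have [_ _ _ QM] := idQ j.
have [->|/Qs Qjs] := eqVneq j i; first by have [_ _ _] := idQ i; apply.
by rewrite mulrC; apply: QM.
Qed.

Lemma ideal_sqrM I f g : I f -> I g -> ideal_pow I 2 (f * g).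
Proof.
move=> If Ig; apply: sub_ideal_span.
exists (fun i : 'I_2 => if i == ord0 then f else g).
  by move=> i; case: ifP.
by rewrite big_ord_recl big_ord1.
Qed.

End Ideals.

(** [f] is the multiple of [s * f] by the element [1 / s] of the localization. *)
Lemma loc_contract_mem (R : idomainType) (P J : set R) (s f : R) :
  P 0 -> ~ P s -> J (s * f) -> loc_contract P J f.
Proof.
move=> P0 nPs Jsf A [[_ _ _ AM] JA].
have s0 : tofrac s != 0.
  by rewrite tofrac_eq0; apply/eqP => s0; apply: nPs; rewrite s0.
have -> : tofrac f = (tofrac 1 / tofrac s) * tofrac (s * f).
  by rewrite tofracM tofrac1 div1r mulKf.
by apply: AM; [exists 1, s | apply: JA; exists (s * f)].
Qed.

(** * Monomial ideals and their minimal generators *)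

Section MonomialIdeals.
Variables (K : fieldType) (n : nat).
Local Notation S := {mpoly K[n]}.
Local Notation is_ideal := (is_ideal_of (@setT S)).
Implicit Types (I Q : set S) (G : set 'X_{1..n}) (F : {set 'I_n}).
Implicit Types (a b c d m : 'X_{1..n}).
Local Notation mon_span := (@mon_span K n).

Lemma ideal_monW I a b :
  is_ideal I -> (a <= b)%MM -> I 'X_[a] -> I 'X_[b].
Proof.
by case=> _ _ _ IM le_ab Ia; rewrite -(submK le_ab) mpolyXD; apply: IM.
Qed.

(** The polynomials all of whose monomials lie in an upward closed set form an
    ideal; this is what turns membership of a monomial in a spanned ideal into
    divisibility conditions on exponents. *)
Lemma msupp_span (U : set 'X_{1..n}) (X : set S) :
  (forall a b, (a <= b)%MM -> U a -> U b) ->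
  (forall f, X f -> forall m, m \in msupp f -> U m) ->
  forall f, ideal_span X f -> forall m, m \in msupp f -> U m.
Proof.
move=> Uup XU f.
suff: ideal_span X `<=` [set f | forall m, m \in msupp f -> U m] by apply.
apply: ideal_span_min => //; split=> //=.
- by move=> m; rewrite msupp0.
- move=> g h Ug Uh m /msuppD_le; rewrite mem_cat.
  by case/orP=> [/Ug|/Uh].
- move=> g h _ Uh m /msuppM_le/allpairsP[[m1 m2] /= [_ /Uh Um2 ->]].
  exact: Uup (lem_addl _ _) Um2.
Qed.

Lemma monomial_ideal_ideal I : is_monomial_ideal I -> is_ideal I.
Proof. by case=> G ->; apply: ideal_span_ideal. Qed.

Lemma mon_span_msupp G f m :
  mon_span G f -> m \in msupp f -> exists2 g, G g & (g <= m)%MM.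
Proof.
move=> Gf; move: m.
apply: (msupp_span (U := [set m | exists2 g, G g & (g <= m)%MM]) _ _ Gf).
  by move=> a b le_ab [g Gg le_ga]; exists g => //; apply: lepm_trans le_ab.
move=> _ [g Gg <-] m; rewrite msuppX inE => /eqP ->; exists g => //.
exact: lepm_refl.
Qed.

Lemma mon_spanX G m : mon_span G 'X_[m] -> exists2 g, G g & (g <= m)%MM.
Proof. by move/mon_span_msupp; apply; rewrite msuppX inE. Qed.

Lemma monomial_ideal_msupp I f m :
  is_monomial_ideal I -> I f -> m \in msupp f -> I 'X_[m].
Proof.
case=> G -> Gf fm; have [g Gg le_gm] := mon_span_msupp Gf fm.
apply: ideal_monW le_gm _; first exact: ideal_span_ideal.
by apply: sub_ideal_span; exists g.
Qed.

(** Minimality is for divisibility among the monomials of [I], which makes sense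
    for every ideal; [min_gensE] identifies these with the minimal generators of
    a monomial ideal. *)
Definition minimal_mon I a : Prop :=
  I 'X_[a] /\ forall b, (b <= a)%MM -> I 'X_[b] -> b = a.

Lemma exists_min_mdeg G : G !=set0 ->
  exists2 a, G a & forall b, G b -> (mdeg a <= mdeg b)%N.
Proof.
case=> a0; move: {2}(mdeg a0) (leqnn (mdeg a0)) => k.
elim: k a0 => [|k IHk] a0 le_a0k Ga0.
  by exists a0 => // b _; apply: leq_trans le_a0k _.
have [[b [Gb lt_b]]|no_b] := pselect (exists b, G b /\ (mdeg b < mdeg a0)%N).
  by apply: (IHk b) => //; rewrite -ltnS; apply: leq_trans le_a0k.
exists a0 => // b Gb; rewrite leqNgt; apply/negP => lt_b.
by apply: no_b; exists b.
Qed.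

Lemma mnm_le_mdeg_eq a b : (a <= b)%MM -> (mdeg b <= mdeg a)%N -> a = b.
Proof.
move=> le_ab; rewrite -(submK le_ab) mdegD -[X in (_ <= X)%N]add0n leq_add2r.
by rewrite leqn0 mdeg_eq0 => /eqP ->; rewrite add0m.
Qed.

Lemma minimal_mon_below I m :
  I 'X_[m] -> exists2 a, minimal_mon I a & (a <= m)%MM.
Proof.
move=> Im.
have [|a [Ia le_am] min_a] :=
    @exists_min_mdeg [set a | I 'X_[a] /\ (a <= m)%MM].
  by exists m; split=> //; apply: lepm_refl.
exists a => //; split=> // b le_ba Ib; apply: mnm_le_mdeg_eq => //.
by apply: min_a; split=> //; apply: lepm_trans le_am.
Qed.

Lemma minimal_mon_span I : is_monomial_ideal I -> I = mon_span (minimal_mon I).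
Proof.
move=> Imon; have idI := monomial_ideal_ideal Imon.
have idM := ideal_span_ideal [set 'X_[K, a] | a in minimal_mon I].
apply/seteqP; split; last first.
  by apply: ideal_span_min => // _ [a [Ia _] <-].
move=> f If; rewrite (mpolyE f) big_seq.
have [_ M0 MD MM] := idM.
apply: (big_ind (fun g => mon_span (minimal_mon I) g)) => // m fm.
rewrite -mul_mpolyC; apply: (MM) => //.
have [a min_a le_am] := minimal_mon_below (monomial_ideal_msupp Imon If fm).
by apply: ideal_monW le_am _ => //; apply: sub_ideal_span; exists a.
Qed.

(** Any monomial generating set contains the minimal monomials, and these already
    generate, so they form the only generating set that is minimal. *)
Lemma min_gensE I : is_monomial_ideal I -> min_gens I = minimal_mon I.
Proof.
move=> Imon; have idI := monomial_ideal_ideal Imon.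
have spanI := minimal_mon_span Imon.
have sub_gens G : I = mon_span G -> minimal_mon I `<=` G.
  move=> defI a [Ia min_a]; have := Ia; rewrite {1}defI => /mon_spanX[g Gg].
  move=> le_ga; rewrite -(min_a g) // defI.
  by apply: sub_ideal_span; exists g.
apply/seteqP; split=> a.
  by case=> G [defI minG] Ga; rewrite (minG (minimal_mon I)) //; apply: sub_gens.
move=> min_a; exists (minimal_mon I) => //; split=> // H sHm defI.
by apply/seteqP; split=> //; apply: sub_gens.
Qed.

(** If x^b lies in [I], the squarefree monomial u with the support of b lies in
    the radical.  The radical has a minimal generator a' with the support of a;
    when the support of b is contained in it, u divides a' and so equals it. *)
Lemma minimal_supp_antichain I a b : is_monomial_ideal I ->
  gens_supports I = gens_supports (radical I) ->
  minimal_mon I a -> I 'X_[b] -> mon_supp b \subset mon_supp a ->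
  mon_supp b = mon_supp a.
Proof.
move=> Imon Isupp min_a Ib sub_ba.
have : gens_supports (radical I) (mon_supp a).
  by rewrite -Isupp; exists a => //; rewrite min_gensE.
case=> a' genJa' supp_a'.
have Jmon : is_monomial_ideal (radical I).
  by case: genJa' => G [defJ _] _; exists G.
move: genJa'; rewrite min_gensE // => -[_ min_a'].
pose u : 'X_{1..n} := [multinom nat_of_bool (i \in mon_supp b) | i < n].
have supp_u : mon_supp u = mon_supp b.
  by apply/setP=> i; rewrite inE mnmE eqb0 negbK.
rewrite -supp_a' -(min_a' u) ?supp_u //.
  apply/mnm_lepP => i; rewrite mnmE; case: (boolP (i \in mon_supp b)) => // bi.
  have : i \in mon_supp a' by rewrite supp_a' (fintype.subsetP sub_ba).
  by rewrite inE lt0n.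
exists (mdeg b); rewrite mpolyXn; apply: ideal_monW Ib.
  exact: monomial_ideal_ideal.
apply/mnm_lepP => i; rewrite mulmnE mnmE inE.
have [->//|bi0] := eqVneq (b i) 0%N.
by rewrite mul1n mdegE (bigD1 i) //= leq_addr.
Qed.

(** [fset_set] sends an infinite set to the empty one, so a count of at least two
    is always a genuine one. *)
Lemma alpha_ge2 I F : (2 <= alpha I F)%N -> exists a b,
  [/\ min_gens I a, min_gens I b, mon_supp a = F, mon_supp b = F & a <> b].
Proof.
rewrite /alpha; set A := [set a | _].
have [finA|infA] := pselect (finite_set A); last first.
  by rewrite /fset_set; case: pselect => //; rewrite cardfs0.
move=> card_A.
have /fset0Pn[a Aa] : fset_set A != fset0.
  by rewrite -cardfs_gt0; apply: leq_trans card_A.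
have /fset0Pn[b] : (fset_set A `\ a)%fset != fset0.
  by rewrite -cardfs_gt0; move: card_A; rewrite (cardfsD1 a) Aa.
rewrite in_fsetD1 => /andP[/eqP neq_ba]; move: Aa.
rewrite !in_fset_set // !inE => -[Ia aF] [Ib bF].
by exists a, b; split=> // eq_ab; apply: neq_ba.
Qed.

(** * Irreducible monomial ideals *)

Definition kill_vars F : S -> S :=
  mmap (@mpolyC n K) (fun i => if i \in F then 0 else 'X_i).
HB.instance Definition _ F := GRing.RMorphism.on (kill_vars F).

(** The identity and [kill_vars F] are ring morphisms agreeing modulo [I] on
    constants and variables, hence everywhere. *)
Lemma kill_vars_cong I F f :
  is_ideal I -> (forall i, i \in F -> I 'X_i) -> I (f - kill_vars F f).
Proof.
move=> [_ I0 ID IM] IF.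
have MP g h : I (g - kill_vars F g) -> I (h - kill_vars F h) ->
    I (g * h - kill_vars F (g * h)).
  move=> Ig Ih; rewrite rmorphM /=.
  have -> : g * h - kill_vars F g * kill_vars F h =
    h * (g - kill_vars F g) + kill_vars F g * (h - kill_vars F h) by ring.
  by apply: ID; apply: IM.
have IC (c : K) : I (c%:MP - kill_vars F c%:MP).
  by rewrite /kill_vars mmapC subrr.
rewrite (mpolyE f); apply: (big_ind (fun g => I (g - kill_vars F g))).
- by rewrite rmorph0 subr0.
- by move=> g h Ig Ih; rewrite rmorphD /= opprD addrACA; apply: ID.
move=> m _; rewrite -mul_mpolyC; apply: (MP) => //.
rewrite mpolyXE_id; apply: (big_ind (fun g => I (g - kill_vars F g))) => //.
  by rewrite rmorph1 subrr.
move=> i _; elim: (m i) => [|k IHk]; first by rewrite expr0 rmorph1 subrr.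
rewrite exprS; apply: MP => //.
rewrite /kill_vars mmapX mmap1U; case: ifP => [/IF|_]; first by rewrite subr0.
by rewrite subrr.
Qed.

(** The radical of (x_i^(q_i), i in F) is the kernel of the substitution
    x_i = 0, i in F, which has values in a domain. *)
Lemma radical_irreducible_prime Q :
  is_irreducible_monomial_ideal Q -> is_prime_ideal (radical Q).
Proof.
case=> F [q [q_gt0 defQ]].
suff -> : radical Q = [set f | kill_vars F f = 0].
  exact: kernel_prime_ideal.
have kerP := kernel_prime_ideal (kill_vars F).
apply/seteqP; split.
  apply: radical_sub_prime => //; rewrite defQ; apply: ideal_span_min.
    split=> //= [|x y /= x0 y0|b x _ /= x0].
    - by rewrite rmorph0.
    - by rewrite rmorphD /= x0 y0 addr0.
    - by rewrite rmorphM /= x0 mulr0.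
  move=> _ [i Fi ->] /=; rewrite rmorphXn /= /kill_vars mmapX mmap1U Fi.
  by rewrite expr0n eqn0Ngt q_gt0.
move=> f /= f0; rewrite -[f]subr0 -f0; apply: kill_vars_cong.
  by apply: radical_ideal; rewrite defQ; apply: ideal_span_ideal.
by move=> i Fi; exists (q i); rewrite defQ; apply: sub_ideal_span; exists i.
Qed.

Lemma irreducible_ideal Q : is_irreducible_monomial_ideal Q -> is_ideal Q.
Proof. by case=> F [q [_ ->]]; apply: ideal_span_ideal. Qed.

(** The exponent of the lcm of x^a, x^b and the square of their gcd.  This monomial
    divides the product of x^a and x^b, and does so properly as soon as they have
    the same support and differ. *)
Definition lcm_sqr_gcd a b : 'X_{1..n} :=
  [multinom maxn (maxn (a i) (b i)) (minn (a i) (b i)).*2 | i < n].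

(** The two factors are pure powers x_i^(q_i) | x^a and x_j^(q_j) | x^b; the term
    2 min (a, b) in [lcm_sqr_gcd] serves the case i = j. *)
Lemma irreducible_lcm_sqr_gcd Q a b : is_irreducible_monomial_ideal Q ->
  Q 'X_[a] -> Q 'X_[b] ->
  exists c d, [/\ Q 'X_[c], Q 'X_[d] & (c + d <= lcm_sqr_gcd a b)%MM].
Proof.
case=> F [q [_ defQ]] Qa Qb.
have memQ m : Q 'X_[m] -> exists2 i, i \in F & (q i <= m i)%N.
  rewrite defQ => Qm.
  apply: (msupp_span (U := [set m | exists2 i, i \in F & (q i <= m i)%N]) _ _ Qm).
  - move=> c d /mnm_lepP le_cd [i Fi le_qc]; exists i => //.
    exact: leq_trans (le_cd i).
  - move=> _ [i Fi ->] c; rewrite mpolyXn msuppX inE => /eqP ->.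
    by exists i => //; rewrite mulmnE mnm1E eqxx mul1n.
  - by rewrite msuppX inE.
have Qpow i : i \in F -> Q 'X_[U_(i) *+ q i].
  move=> Fi; rewrite defQ; apply: sub_ideal_span; exists i => //.
  by rewrite mpolyXn.
have [i Fi le_qa] := memQ _ Qa; have [j Fj le_qb] := memQ _ Qb.
exists (U_(i) *+ q i)%MM, (U_(j) *+ q j)%MM; split; [exact: Qpow..|].
apply/mnm_lepP => k; rewrite mnmDE !mulmnE !mnm1E mnmE.
by have [eq_ik|_] := eqVneq i k; have [eq_jk|_] := eqVneq j k; subst; lia.
Qed.

(** * The symbolic and the ordinary square *)

Lemma lcm_sqr_gcd_symbolic I a b : has_minimal_irreducible_decomposition I ->
  I 'X_[a] -> I 'X_[b] -> symbolic_pow I 2 'X_[lcm_sqr_gcd a b].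
Proof.
case=> r [Q [[irrQ defI _] injQ]] Ia Ib P minP.
have Pp : is_prime_ideal P by case: minP.
have [i [s nPs sQI]] := local_component defI
  (fun i => irreducible_ideal (irrQ i))
  (fun i => radical_irreducible_prime (irrQ i)) injQ minP.
have IQ : I `<=` Q i by rewrite defI => f; apply.
have [c [d [Qc Qd le_cd]]] := irreducible_lcm_sqr_gcd (irrQ i) (IQ _ Ia) (IQ _ Ib).
apply: (@loc_contract_mem _ _ _ (s * s)); first exact: prime_ideal0.
  by move=> /(prime_idealM Pp) [].
have [_ _ _ powM] : is_ideal (ideal_pow I 2) := ideal_span_ideal _.
rewrite -(submK le_cd) !mpolyXD.
have -> : forall u v w : S, s * s * (u * (v * w)) = u * ((s * v) * (s * w)).
  by move=> u v w; ring.
by apply: powM => //; apply: ideal_sqrM; apply: sQI.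
Qed.

Lemma monomial_sqrX I m : is_monomial_ideal I -> ideal_pow I 2 'X_[m] ->
  exists c d, [/\ I 'X_[c], I 'X_[d] & (c + d <= m)%MM].
Proof.
move=> Imon Im.
apply: (msupp_span (U := [set m | exists c d,
    [/\ I 'X_[c], I 'X_[d] & (c + d <= m)%MM]]) _ _ Im).
- move=> a b le_ab [c [d [Ic Id le_a]]]; exists c, d; split=> //.
  exact: lepm_trans le_ab.
- move=> _ [f If ->] c; rewrite big_ord_recl big_ord1.
  move=> /msuppM_le/allpairsP[[c1 c2] /= [fc1 fc2 ->]]; exists c1, c2.
  split; [exact: monomial_ideal_msupp fc1|exact: monomial_ideal_msupp fc2|].
  exact: lepm_refl.
- by rewrite msuppX inE.
Qed.

End MonomialIdeals.

Theorem lemma2p1 (K : fieldType) (n : nat) (I : set {mpoly K[n]})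
    (I_mon : is_monomial_ideal I)
    (I_supp : gens_supports I = gens_supports (radical I))
    (I_min : has_minimal_irreducible_decomposition I)
    (I_alpha : exists2 F : {set 'I_n}, gens_supports I F & (2 <= alpha I F)%N) :
  symbolic_pow I 2 <> ideal_pow I 2.
Proof.
case: I_alpha => F _ /alpha_ge2[a0 [b0 []]]; rewrite !min_gensE //.
move=> min_a0 min_b0 a0F b0F neq_ab0 sym_eq.
pose G := [set a | minimal_mon I a /\ mon_supp a = F].
have [|a [min_a aF] deg_a] := @exists_min_mdeg n G; first by exists a0.
have [|b [[min_b bF] neq_ba] deg_b] := @exists_min_mdeg n (G `&` [set b | b <> a]).
  have [eq_a|neq_a] := pselect (a0 = a); last by exists a0.
  by exists b0; split=> // eq_b; apply: neq_ab0; rewrite eq_a.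
have [Ia _] := min_a; have [Ib minb] := min_b.
(* Otherwise x^a would properly divide the minimal generator x^b. *)
have [k lt_k] : exists k, (b k < a k)%N.
  apply/not_existsP => ge_ab; apply: neq_ba; apply/esym/minb => //.
  by apply/mnm_lepP => i; rewrite leqNgt; apply/negP.
have bk_gt0 : (0 < b k)%N.
  have : k \in mon_supp b by rewrite bF -aF inE -lt0n (leq_ltn_trans _ lt_k).
  by rewrite inE lt0n.
have := lcm_sqr_gcd_symbolic I_min Ia Ib; rewrite sym_eq.
case/(monomial_sqrX I_mon) => c' [d' [Ic' Id' le_cd']].
have [c min_c le_c] := minimal_mon_below Ic'.
have [d min_d le_d] := minimal_mon_below Id'.
have le_cd i : (c i + d i <= maxn (maxn (a i) (b i)) (minn (a i) (b i)).*2)%N.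
  have := mnm_lepP le_cd' i; rewrite mnmDE [X in (_ <= X)%N -> _]mnmE.
  by apply: leq_trans; apply: leq_add; apply/mnm_lepP.
(* Both c and d are at most f, which vanishes outside F; the antichain property
   then makes their supports equal to F. *)
have suppF e : minimal_mon I e -> (forall i, (e i <= c i + d i)%N) -> G e.
  move=> min_e le_e; split=> //; rewrite -aF.
  have [Ie _] := min_e.
  apply: (minimal_supp_antichain I_mon I_supp) => //.
  apply/fintype.subsetP => i; rewrite [i \in mon_supp a]inE.
  apply: contraLR; rewrite negbK => ai0.
  have bi0 : b i == 0%N.
    apply: negbNE; apply/negP => bi; have : i \in mon_supp b by rewrite inE.
    by rewrite bF -aF inE ai0.
  rewrite inE negbK -leqn0; apply: leq_trans (le_e i) _.
  by have := le_cd i; rewrite (eqP ai0) (eqP bi0).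
have Gc : G c by apply: suppF => // i; apply: leq_addr.
have Gd : G d by apply: suppF => // i; apply: leq_addl.
have lt_deg : (mdeg c + mdeg d < mdeg a + mdeg b)%N.
  rewrite -!mdegD ltnNge; apply/negP => deg_ge.
  have eq_cd : (c + d)%MM = (a + b)%MM.
    apply: mnm_le_mdeg_eq => //; apply/mnm_lepP => i; rewrite !mnmDE.
    by apply: leq_trans (le_cd i) _; lia.
  have /(congr1 (fun m : 'X_{1..n} => m k)) := eq_cd; rewrite !mnmDE.
  by have := le_cd k; lia.
(* By the choice of a and b, a generator other than x^a has degree at least
   that of x^b, and every one has degree at least that of x^a. *)
have eq_a e e' : G e -> G e' -> (mdeg e + mdeg e' < mdeg a + mdeg b)%N -> e = a.
  move=> Ge Ge' lt_ee'; apply: contrapT => neq_e.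
  have := deg_b e (conj Ge neq_e); have := deg_a e' Ge'; lia.
have ca := eq_a c d Gc Gd lt_deg.
have da : d = a by apply: (eq_a d c) => //; rewrite addnC.
by have := le_cd k; rewrite ca da; lia.
Qed.
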